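(* Let $r\ge2$. If $H$ is a linear $r$-graph whose girth is finite and odd, then $H$ is not Sidorenko.
   Context: An $r$-graph is a finite $r$-uniform hypergraph; it is linear if any two distinct edges share at most one vertex. A (loose) cycle of length $g\ge3$ in a linear $r$-graph consists of $g$ distinct edges $e_1,\dots,e_g$ and $g$ distinct vertices $v_1,\dots,v_g$ with $v_i\in e_i\cap e_{i+1}$ (indices mod $g$). The girth is the length of a shortest cycle. For a symmetric measurable $W:[0,1]^r\to[0,1]$, $t_H(W)=\int_{[0,1]^{V(H)}}\prod_{\{u_1,\dots,u_r\}\in E(H)}W(x_{u_1},\dots,x_{u_r})\,dx$. $H$ is Sidorenko if $t_H(W)\ge(\int_{[0,1]^r}W)^{\mathrm{e}(H)}$ for every such $W$, where $\mathrm{e}(H)$ is the number of edges. *)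

(* Defs.v *)
From HB Require Import structures.
From mathcomp Require Import all_boot all_order all_algebra perm.
From mathcomp Require Import all_classical all_reals all_analysis.

Set Implicit Arguments.
Unset Strict Implicit.
Unset Printing Implicit Defensive.

Import Order.TTheory GRing.Theory Num.Theory.

Local Open Scope classical_set_scope.
Local Open Scope ring_scope.

Section TupleLebesgue.
Variable R : realType.

Local Notation RT := (measurableTypeR R).

Definition tcons n (p : RT * n.-tuple RT) : n.+1.-tuple RT :=
  [tuple of p.1 :: p.2].

(* The n-fold product of the one-dimensional Lebesgue measure, on the product
   sigma-algebra that the library puts on n.-tuple.  It is built one coordinate
   at a time and transported along R * R^n ~ R^(n+1); tuple_lebesgue_box below
   gives its value on boxes. *)
Fixpoint tuple_lebesgue n : set (n.-tuple RT) -> \bar R :=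
  if n is m.+1 then
    pushforward (product_measure1 (@lebesgue_measure R) (@tuple_lebesgue m))
      (@tcons m)
  else \d_([tuple] : 0.-tuple RT).

Lemma measurable_tcons n : measurable_fun setT (@tcons n).
Proof. exact: measurable_cons. Qed.

Section Step.
Variables (n : nat) (m : {sigma_finite_measure set (n.-tuple RT) -> \bar R}).

Let step : set (n.+1.-tuple RT) -> \bar R :=
  pushforward (product_measure1 (@lebesgue_measure R) m) (@tcons n).

Let stepM : {measure set (n.+1.-tuple RT) -> \bar R} :=
  measure_function_pushforward__canonical__measure_function_Measure
    (product_measure1 (@lebesgue_measure R) m) (@measurable_tcons n).

Let step0 : step set0 = 0%E. Proof. exact: (measure0 stepM). Qed.
Let step_ge0 A : (0 <= step A)%E. Proof. exact: (measure_ge0 stepM). Qed.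
Let step_sigma : semi_sigma_additive step.
Proof. exact: (@measure_semi_sigma_additive _ _ _ stepM). Qed.

HB.instance Definition _ := isMeasure.Build _ _ _ step step0 step_ge0 step_sigma.

Let step_sf : sigma_finite setT step.
Proof.
have /sigma_finiteP[F [FT ndF Foo]] := sigma_finiteT (@lebesgue_measure R).
have /sigma_finiteP[G [GT ndG Goo]] := sigma_finiteT m.
pose g (x : n.+1.-tuple RT) : RT * n.-tuple RT :=
  (thead x, [tuple of behead x]).
have mg : measurable_fun setT g.
  apply: measurable_fun_pair; first exact: measurable_tnth.
  exact: measurable_behead.
have gK p : g (tcons p) = p by case: p => a t; congr pair; apply/val_inj.
exists (fun i => g @^-1` (F i `*` G i)).
  apply/esym/seteqP; split => // x _.
  have [i _ Fi] : (\bigcup_i F i) (g x).1 by rewrite -FT.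
  have [j _ Gj] : (\bigcup_i G i) (g x).2 by rewrite -GT.
  exists (maxn i j) => //; split.
  - by move: Fi; exact/subsetPset/ndF/leq_maxl.
  - by move: Gj; exact/subsetPset/ndG/leq_maxr.
move=> i; have [mFi Fi] := Foo i; have [mGi Gi] := Goo i; split.
  by rewrite -[X in measurable X]setTI; apply: mg => //; exact: measurableX.
rewrite /step /pushforward (_ : _ @^-1` _ = F i `*` G i).
  by rewrite product_measure1E// lte_mul_pinfty// ge0_fin_numE.
rewrite -comp_preimage (_ : g \o _ = id) ?preimage_id//.
by apply/funext => p; exact: gK.
Qed.

HB.instance Definition _ := Measure_isSigmaFinite.Build _ _ _ step step_sf.

Lemma tuple_lebesgue_step :
  exists m' : {sigma_finite_measure set (n.+1.-tuple RT) -> \bar R},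
    (m' : set _ -> \bar R) = step.
Proof. by exists step. Qed.

End Step.

Lemma tuple_lebesgueP n :
  exists m : {sigma_finite_measure set (n.-tuple RT) -> \bar R},
    (m : set _ -> \bar R) = @tuple_lebesgue n.
Proof.
elim: n => [|n [m mE]]; first by exists \d_([tuple] : 0.-tuple RT).
by have [m' m'E] := tuple_lebesgue_step m; exists m'; rewrite m'E mE.
Qed.

Section Instances.
Variable n : nat.

Let tl0 : @tuple_lebesgue n set0 = 0%E.
Proof. by have [m <-] := tuple_lebesgueP n; exact: measure0. Qed.

Let tl_ge0 A : (0 <= @tuple_lebesgue n A)%E.
Proof. by have [m <-] := tuple_lebesgueP n; exact: measure_ge0. Qed.

Let tl_sigma : semi_sigma_additive (@tuple_lebesgue n).
Proof.
by have [m <-] := tuple_lebesgueP n; exact: measure_semi_sigma_additive.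
Qed.

HB.instance Definition _ :=
  isMeasure.Build _ _ _ (@tuple_lebesgue n) tl0 tl_ge0 tl_sigma.

Let tl_sf : sigma_finite setT (@tuple_lebesgue n).
Proof. by have [m <-] := tuple_lebesgueP n; exact: sigma_finiteT. Qed.

HB.instance Definition _ :=
  Measure_isSigmaFinite.Build _ _ _ (@tuple_lebesgue n) tl_sf.

End Instances.

Lemma tuple_lebesgue_box n (A : 'I_n -> set RT) :
  (forall i, measurable (A i)) ->
  @tuple_lebesgue n [set x | forall i, A i (tnth x i)] =
    (\prod_(i < n) @lebesgue_measure R (A i))%E.
Proof.
elim: n A => [|n IH] A mA.
  rewrite big_ord0 /= diracE mem_set//; by case.
have mbox : measurable
    [set x : n.-tuple RT | forall i, A (lift ord0 i) (tnth x i)].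
  rewrite (_ : mkset _ = \bigcap_(i in setT)
     ((@tnth n RT)^~ i @^-1` A (lift ord0 i))).
    apply: fin_bigcap_measurable => // i _; rewrite -[X in measurable X]setTI.
    exact: measurable_tnth.
  by apply/seteqP; split => x /= H i => [_|]; exact: H.
rewrite big_ord_recl -IH// -product_measure1E//= /pushforward.
congr product_measure1; apply/seteqP; split => -[a t] /=.
- move=> H; split; first exact: (H ord0).
  by move=> i; have := H (lift ord0 i); rewrite /tcons tnthS.
- move=> [H1 H2] i; case: (unliftP ord0 i) => [j ->|->] //.
  by rewrite /tcons tnthS; exact: H2.
Qed.

Definition unit_cube n : set (n.-tuple RT) :=
  [set x | forall i, 0 <= (tnth x i : R) <= 1].

End TupleLebesgue.

Section Hypergraph.
Variable V : finType.
Implicit Types (r g : nat) (H : {set {set V}}).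

Definition uniform_hypergraph r H := forall e, e \in H -> #|e| = r.

Definition linear_hypergraph H :=
  forall e f, e \in H -> f \in H -> e != f -> (#|e :&: f| <= 1)%N.

(* ordS is the cyclic successor on 'I_g. *)
Definition has_cycle H g :=
  (3 <= g)%N /\
  exists (e : 'I_g -> {set V}) (v : 'I_g -> V),
    [/\ injective e, injective v, forall i, e i \in H
      & forall i, v i \in e i :&: e (ordS i)].

Definition girth_is H g :=
  has_cycle H g /\ forall k, has_cycle H k -> (g <= k)%N.

End Hypergraph.

Section Sidorenko.
Variable R : realType.

Local Notation RT := (measurableTypeR R).

Definition symmetric_kernel r (W : r.-tuple RT -> R) :=
  forall (s : {perm 'I_r}) x, unit_cube x ->
    W [tuple tnth x (s i) | i < r] = W x.

(* A symmetric measurable function [0,1]^r -> [0,1]; only the values on the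
   cube matter. *)
Definition unit_kernel r (W : r.-tuple RT -> R) :=
  [/\ measurable_fun (@unit_cube R r) W, symmetric_kernel W
    & forall x, unit_cube x -> 0 <= W x <= 1].

(* A point of [0,1]^V is a #|V|.-tuple, the coordinate of v being the one of
   index enum_rank v.  The vertices of an edge e are listed in the order of
   enum e, which is immaterial as W is symmetric; when e has r elements the
   default value of nth is never used. *)
Definition edge_coords (V : finType) r (x : #|V|.-tuple RT) (e : {set V}) :
    r.-tuple RT :=
  [tuple nth (0 : R) [seq tnth x (enum_rank v) | v <- enum e] i | i < r].

Definition hom_density (V : finType) r (H : {set {set V}})
    (W : r.-tuple RT -> R) : R :=
  \int[@tuple_lebesgue R #|V|]_(x in @unit_cube R #|V|)
    \prod_(e in H) W (edge_coords r x e).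

Definition edge_density r (W : r.-tuple RT -> R) : R :=
  \int[@tuple_lebesgue R r]_(x in @unit_cube R r) W x.

Definition sidorenko (V : finType) r (H : {set {set V}}) :=
  forall W : r.-tuple RT -> R, unit_kernel W ->
    edge_density W ^+ #|H| <= hom_density H W.

End Sidorenko.

(* Main.v *)
(* Take the kernel W = (1 - eps f) / 2 with f(x) the sum of phi(x_i) phi(x_j)
   over ordered pairs i <> j, where phi = 1 on [0, 1/2[ and phi = -1 on
   [1/2, 1].  Its edge density is 1/2.  Expanding the product over the edges of
   H, 2^e(H) t_H(W) is the sum, over all ways to select a pair of vertices in
   each edge of a subset F of H such that the selected pairs form a graph with
   all degrees even, of (- eps)^|F|.  A nonempty even graph contains a cycle,
   which is a loose cycle of H, so |F| is 0 or at least the girth g; as g is odd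
   and the girth cycle itself contributes, the sum is at most
   1 - eps^g + O(eps^(g+1)). *)
Require Import Defs.
From mathcomp Require Import all_boot all_order all_algebra.
From mathcomp Require Import all_classical all_reals all_analysis.
From mathcomp Require Import perm measurable_realfun lra zify.

Set Implicit Arguments.
Unset Strict Implicit.
Unset Printing Implicit Defensive.

Import Order.TTheory GRing.Theory Num.Theory.

Local Open Scope ring_scope.

(** * Even selections of vertex pairs and loose cycles *)

Section PairSelection.
Variable V : finType.
Implicit Types (H : {set {set V}}) (h : {ffun {set V} -> option (V * V)}).

Definition incident (o : option (V * V)) (v : V) : bool :=
  if o is Some p then (v == p.1) || (v == p.2) else false.

(** [None] leaves [e] out of the chosen subset of [H]. Non-edges admit only [None], so a selection
    can be indexed by all of [{set V}]. *)
Definition selectable H (e : {set V}) (o : option (V * V)) : bool :=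
  if o is Some p then [&& e \in H, p.1 != p.2, p.1 \in e & p.2 \in e]
  else true.

Definition selected h : {set {set V}} := [set e | h e != None].

Definition even_selection h : bool :=
  [forall v, ~~ odd (\sum_e incident (h e) v)].

Lemma incident_selected h e v : incident (h e) v -> e \in selected h.
Proof. by rewrite inE; case: (h e). Qed.

Lemma selectable_incident H e o v :
  selectable H e o -> incident o v -> e \in H /\ v \in e.
Proof. by case: o => //= p /and4P[eH _ p1 p2] /orP[] /eqP ->. Qed.

(** The pair of [e] adds one to the even degree of its other end [w], so a second pair meets [w]: a
    walk crossing [e] from [v] can go on without turning back. *)
Lemma even_selection_step H h e v :
  selectable H e (h e) -> even_selection h -> incident (h e) v ->
  exists f w, [/\ incident (h f) w, incident (h e) w, w != v & f != e].
Proof.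
move=> he ev hv.
have [w [wv hw]] : exists w, w != v /\ incident (h e) w.
  move: he hv; case: (h e) => //= -[a b] /= /and4P[_ ab _ _].
  case/orP=> /eqP ->; [exists b|exists a]; rewrite eqxx ?orbT //.
  by rewrite eq_sym.
have [f /andP[fe hf]|no] := pickP (fun f => (f != e) && incident (h f) w).
  by exists f, w.
have := forallP ev w; rewrite (bigD1 e)//= hw big1 // => f fe.
by have := no f; rewrite fe /= => ->.
Qed.

Lemma incident_eq H e o a b c : selectable H e o -> a != b ->
  incident o a -> incident o b -> incident o c -> (c == a) || (c == b).
Proof.
case: o => //= p _ ab /orP[]/eqP ? /orP[]/eqP ? hc; subst;
  by rewrite ?eqxx // in ab hc *; rewrite orbC in hc *.
Qed.

(* A nonempty even multigraph has minimum degree at least two on its support,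
   so it carries an infinite non-backtracking walk; a closed segment of minimal
   length of that walk is a loose cycle. *)
Lemma even_selection_cycle H h :
  linear_hypergraph H -> (forall e, selectable H e (h e)) ->
  even_selection h -> (0 < #|selected h|)%N ->
  exists2 m, has_cycle H m & (m <= #|selected h|)%N.
Proof.
move=> linH selH evh /card_gt0P[e0]; rewrite inE => he0.
have [v0 hv0] : exists v, incident (h e0) v.
  by move: he0; case: (h e0) => // -[a b] _; exists a; rewrite /= eqxx.
(* A state of the walk is a set with one end of its selected pair; [f] crosses to the other end and
   switches to a different set there. *)
pose S := {x : {set V} * V | incident (h x.1) x.2}.
have /choice[f fP] : forall x : S, exists y : S,
    [/\ incident (h (sval x).1) (sval y).2, (sval y).2 != (sval x).2
      & (sval y).1 != (sval x).1].
  move=> [[e v] /= hev].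
  have [e' [w [hw ? ? ?]]] := even_selection_step (selH e) evh hev.
  by exists (exist (fun y : {set V} * V => incident (h y.1) y.2) (e', w) hw).
pose x n : S := iter n f (exist _ (e0, v0) hv0).
pose e n := (sval (x n)).1; pose v n := (sval (x n)).2.
have inc0 n : incident (h (e n)) (v n) := svalP (x n).
have inc1 n : incident (h (e n)) (v n.+1) by have [] := fP (x n).
have vS n : v n.+1 != v n by have [] := fP (x n).
have eS n : e n.+1 != e n by have [] := fP (x n).
have eH n : e n \in H by have [] := selectable_incident (selH _) (inc0 n).
have ve n : v n \in e n by have [] := selectable_incident (selH _) (inc0 n).
have vSe n : v n.+1 \in e n.
  by have [] := selectable_incident (selH _) (inc1 n).
(* Pigeonhole on the first [#|V|.+1] vertices of the walk. *)
have exm : exists m, `[< (0 < m)%N /\ exists i, v i = v (i + m)%N >].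
  pose u (i : 'I_(#|V|.+1)) := v i.
  have /injectivePn[i [j ij uij]] : ~~ injectiveb u.
    apply/negP => /injectiveP /leq_card; rewrite card_ord; lia.
  wlog lt_ij : i j ij uij / (i < j)%N.
    move=> wl; have [|?|/val_inj/eqP] := ltngtP i j; [exact: wl| |].
    - by apply: (wl j i); rewrite // eq_sym.
    - by rewrite (negbTE ij).
  exists (j - i)%N; apply/asboolP; split; first lia.
  by exists i; rewrite subnKC // ltnW.
pose m := ex_minn exm.
have [/asboolP[m0 [i vi]] mmin] :
    `[< (0 < m)%N /\ exists i, v i = v (i + m)%N >] /\
    forall k j, (0 < k)%N -> v j = v (j + k)%N -> (m <= k)%N.
  rewrite /m; case: ex_minnP => k k0 kmin; split=> // l j l0 jl.
  by apply: kmin; apply/asboolP; split=> //; exists j.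
have far a b : (a < b)%N -> v a = v b -> (m <= b - a)%N.
  by move=> ab vab; apply: (mmin _ a); rewrite ?subn_gt0 // subnKC // ltnW.
have mn1 : m != 1%N.
  by apply/eqP => m1; move: vi; rewrite m1 addn1 => /esym/eqP; apply/negP.
(* A return after two steps would put both [v i] and [v i.+1] in the distinct edges [e i] and
   [e i.+1], against linearity. *)
have mn2 : m != 2%N.
  apply/eqP => m2; move: vi; rewrite m2 addn2 => vi.
  have := linH _ _ (eH i.+1) (eH i) (eS i); apply/negP; rewrite -ltnNge.
  rewrite (cardD1 (v i)) (cardD1 (v i.+1)) !inE ve vSe vS ve.
  by rewrite [in v i \in _]vi vSe.
have m3 : (3 <= m)%N by lia.
(* If [e a = e b], the selected pair has ends [v a] and [v b], so [v a.+1 = v b]. Either [b = a.+1]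
   and an edge repeats at once, or a vertex recurs after fewer than [m] steps. *)
have einj a b : (a < b)%N -> (b - a < m)%N -> e a != e b.
  move=> ab bam; apply/eqP => eab.
  have va : v a != v b by apply/eqP => /(far _ _ ab); lia.
  have va1 : v a.+1 = v b.
    have incb : incident (h (e a)) (v b) by rewrite eab.
    have /orP[/eqP h1|/eqP //] := incident_eq (selH _) va (inc0 a) incb (inc1 a).
    by have := vS a; rewrite h1 eqxx.
  have [ba1|ba1] := eqVneq b a.+1.
    by have := eS a; rewrite eab ba1 eqxx.
  by have := far a.+1 b _ va1; lia.
(* The shift by one is needed because [v n.+1] is the vertex common to [e n] and [e n.+1]; at the
   wrap-around, [v (i + m) = v i] closes the cycle. *)
pose c (t : 'I_m) := e (i + t)%N; pose w (t : 'I_m) := v (i + t).+1.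
have cinj : injective c.
  move=> s t; case: (ltngtP s t) => [st|st|/val_inj //] /eqP;
    apply: contraTeq => _.
  - by apply: einj; have := ltn_ord t; lia.
  - by rewrite eq_sym; apply: einj; have := ltn_ord s; lia.
exists m.
  split=> //; exists c, w; split=> //.
  - move=> s t; case: (ltngtP s t) => [st|st|/val_inj //] wst.
    + by have := far (i + s).+1 (i + t).+1 _ wst; have := ltn_ord t; lia.
    + by have := far (i + t).+1 (i + s).+1 _ (esym wst); have := ltn_ord s; lia.
  - by move=> t; exact: eH.
  - move=> t; rewrite inE vSe /c /w /=.
    have [tm|] := ltnP t.+1 m; first by rewrite modn_small // addnS ve.
    move=> mt; have -> : t.+1 = m by apply/eqP; rewrite eqn_leq mt ltn_ord.
    by rewrite modnn addn0 -addnS (_ : t.+1 = m) -?vi //; have := ltn_ord t; lia.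
rewrite -[m in (m <= _)%N]card_ord -(card_imset _ cinj); apply: subset_leq_card.
by apply/fintype.subsetP => _ /imsetP[t _ ->]; exact: incident_selected (inc0 _).
Qed.

(** The edge [e (ordS i)] contains [v i] and [v (ordS i)] and selects that pair; each cycle vertex
    is then first in one pair and second in another, so it has degree two. *)
Lemma cycle_selection H g : has_cycle H g ->
  exists h, [/\ forall e, selectable H e (h e), even_selection h
    & #|selected h| = g].
Proof.
move=> [g3 [e [v [einj vinj eH ve]]]].
have ordS_neq (i : 'I_g) : i != ordS i.
  apply/eqP => /(congr1 val) /=; have [ig|gi] := ltnP i.+1 g.
    by rewrite modn_small //; lia.
  by have -> : i.+1 = g :> nat; [have := ltn_ord i; lia|rewrite modnn; lia].
pose h := [ffun f : {set V} =>
  omap (fun i => (v i, v (ordS i))) [pick i | e (ordS i) == f]].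
have eSinj : injective (e \o @ordS g).
  exact: inj_comp einj (bij_inj (@ordS_bij g)).
have he i : h (e (ordS i)) = Some (v i, v (ordS i)).
  rewrite ffunE; case: pickP => [j /eqP /eSinj -> //|/(_ i)].
  by rewrite eqxx.
have hN f : f \notin codom (e \o @ordS g) -> h f = None.
  move=> fN; rewrite ffunE; case: pickP => [j /eqP fE|//].
  by move: fN; rewrite -fE codom_f.
exists h; split.
- move=> f; have [/codomP[i ->]/=|/hN -> //] := boolP (f \in codom (e \o @ordS g)).
  rewrite he /= eH (inj_eq vinj) ordS_neq /=.
  by have := ve i; have := ve (ordS i); rewrite !inE => /andP[-> _] /andP[_ ->].
- apply/forallP => x.
  rewrite (bigID (fun f => f \in codom (e \o @ordS g)))/= [X in (_ + X)%N]big1.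
    rewrite addn0 -big_uniq /=; last by rewrite map_inj_uniq ?enum_uniq.
    rewrite big_map big_enum /=.
    rewrite (eq_bigr (fun i => (x == v i) + (x == v (ordS i)))%N) => [|i _].
      rewrite big_split /=.
      rewrite -(reindex (@ordS g) (P := predT)
        (F := fun i => nat_of_bool (x == v i))).
        by rewrite addnn odd_double.
      exact: onW_bij (@ordS_bij g).
    rewrite he /=; case: eqVneq => [->|_] //=.
    by rewrite (inj_eq vinj) (negbTE (ordS_neq i)).
  by move=> f /hN ->.
- have -> : selected h = [set f in codom (e \o @ordS g)].
    apply/setP => f; rewrite !inE.
    have [/codomP[i ->]/=|/hN -> //] := boolP (f \in codom (e \o @ordS g)).
    by rewrite he.
  by rewrite cardsE card_codom // card_ord.
Qed.

(** * Sign sums over two-colourings of the vertices *)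

Variable R : realFieldType.
Implicit Types s : {ffun V -> bool}.

Definition pair_sign (s : {ffun V -> bool}) (o : option (V * V)) : R :=
  if o is Some p then (-1) ^+ s p.1 * (-1) ^+ s p.2 else 1.

(** Spreading the sign over all vertices lets sums over [s] factor vertex by vertex. *)
Lemma pair_signE H e o s : selectable H e o ->
  pair_sign s o = \prod_v ((-1) ^+ s v) ^+ incident o v.
Proof.
case: o => [[a b]|_] /=; last by rewrite big1.
case/and4P=> _ ab _ _; rewrite (bigD1 a) //= (bigD1 b) 1?eq_sym //= !eqxx orbT.
rewrite !expr1 big1 ?mulr1 // => c /andP[/negbTE -> /negbTE ->] //.
Qed.

(** The sum factors over the vertices; one of degree [d] gives [1 + (-1) ^+ d], which is 2 or 0
    according to parity. *)
Lemma sum_pair_sign H h : (forall e, selectable H e (h e)) ->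
  \sum_s \prod_e pair_sign s (h e) = 2 ^+ #|V| *+ even_selection h.
Proof.
move=> selH.
under eq_bigr => s _.
  under eq_bigr => e _ do rewrite (pair_signE _ (selH e)).
  rewrite exchange_big /=.
  under eq_bigr => v _ do rewrite -expr_sum.
  over.
rewrite -(bigA_distr_bigA (fun v b => ((-1) ^+ nat_of_bool b : R) ^+ _)) /=.
have [/forallP ev|/forallPn[v]] := boolP (even_selection h).
  rewrite mulr1n -prodr_const; apply: eq_bigr => v _.
  by rewrite big_bool /= expr1 expr0 expr1n -signr_odd (negbTE (ev v)) expr0.
rewrite negbK mulr0n => odv; apply/eqP/prodf_eq0; exists v => //.
by rewrite big_bool /= expr1 expr0 expr1n -signr_odd odv expr1 addNr.
Qed.

Lemma sum_pair_sign1 H (e : {set V}) (p : V * V) :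
  selectable H e (Some p) -> \sum_s pair_sign s (Some p) = 0.
Proof.
move=> selp.
under eq_bigr => s _ do rewrite (pair_signE _ selp).
rewrite -(bigA_distr_bigA
  (fun v b => ((-1) ^+ nat_of_bool b : R) ^+ incident (Some p) v)) /=.
apply/eqP/prodf_eq0; exists p.1 => //.
by rewrite big_bool /= eqxx /= !expr1 expr0 addNr.
Qed.

(** Distributivity: in the factor of [e], [None] picks the 1 and [Some p] picks one term of the
    inner sum, with weight [- eps]. *)
Lemma prod_selection_expand H (eps : R) s :
  \prod_(e in H) (1 - eps * \sum_(p | selectable H e (Some p))
                                 pair_sign s (Some p)) =
  \sum_(h in family (selectable H)) (- eps) ^+ #|selected h| *
                                      \prod_e pair_sign s (h e).
Proof.
rewrite big_mkcond /=.
pose F o := (if o is Some _ then - eps else 1) * pair_sign s o.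
have -> : \sum_(h in family (selectable H)) (- eps) ^+ #|selected h| *
    \prod_e pair_sign s (h e) =
    \sum_(h in family (selectable H)) \prod_e F (h e).
  apply: eq_bigr => h _; rewrite big_split /=; congr (_ * _).
  rewrite -prodr_const big_mkcond /=; apply: eq_bigr => e _.
  by rewrite inE; case: (h e).
rewrite -(bigA_distr_big_dep (selectable H) (fun=> F)) /=; apply: eq_bigr => e _.
rewrite (bigD1 None) //= {1}/F /= mulr1.
rewrite (reindex_omap Some id) /=; last by case=> [p|] //=; rewrite andbF.
have -> : \sum_(p | [&& selectable H e (Some p) && (Some p != None)
   & Some p == Some p]) F (Some p) =
   - eps * \sum_(p | selectable H e (Some p)) pair_sign s (Some p).
  by rewrite mulr_sumr; apply: eq_big => p //=; rewrite eqxx !andbT.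
case: ifP => [_|eH]; first by rewrite mulNr.
by rewrite big1 ?mulr0 ?addr0 // => p /=; rewrite eH.
Qed.

Lemma sum_prod_selection_lt H g (eps : R) :
  linear_hypergraph H -> girth_is H g -> odd g ->
  0 < eps -> eps <= 1 -> eps * #|{ffun {set V} -> option (V * V)}|%:R < 1 ->
  \sum_s \prod_(e in H) (1 - eps * \sum_(p | selectable H e (Some p))
                                 pair_sign s (Some p)) < 2 ^+ #|V|.
Proof.
move=> linH [cycH gmin] oddg eps0 eps1 epsN.
under eq_bigr do rewrite prod_selection_expand.
rewrite exchange_big /=.
under eq_bigr => h /familyP selH
  do rewrite -mulr_sumr (sum_pair_sign selH) mulrnAr mulrC -mulrnAr.
rewrite -mulr_sumr -[ltRHS]mulr1 ltr_pM2l ?exprn_gt0 //.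
(* With [2 ^+ #|V|] factored out, the empty selection [h0] contributes 1 and the girth cycle [h1]
   contributes [- eps ^+ g], as [g] is odd. *)
have [h1 [selh1 evh1 cardh1]] := cycle_selection cycH.
pose h0 : {ffun {set V} -> option (V * V)} := [ffun=> None].
have card0 : #|selected h0| = 0%N.
  by apply: eq_card0 => e; rewrite !inE ffunE.
have h10 : h1 != h0.
  by apply/eqP => h10; have [] := cycH; rewrite -cardh1 h10 card0.
have even0 : even_selection h0.
  by apply/forallP => v; rewrite big1 // => e _; rewrite ffunE.
rewrite (bigD1 h0) /=; last by apply/familyP => e; rewrite ffunE.
rewrite card0 expr0 even0 mulr1n -[ltRHS]addr0 ltrD2l.
rewrite (bigD1 h1) /=; last by rewrite h10 andbT; exact/familyP.
rewrite cardh1 evh1 mulr1n exprNn -signr_odd oddg expr1 mulN1r addrC subr_lt0.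
(* A nonempty even selection has at least [g] pairs. Exactly [g] gives a negative term; more give
   absolute value at most [eps ^+ g.+1] because [eps <= 1]. *)
have term_le h : h \in family (selectable H) -> h != h0 ->
    (- eps) ^+ #|selected h| *+ even_selection h <= eps ^+ g.+1.
  move=> /familyP selH hh0.
  have [evh|_] := boolP (even_selection h); last by rewrite mulr0n exprn_ge0 ?ltW.
  have : (0 < #|selected h|)%N.
    rewrite lt0n; apply: contra hh0 => /eqP/card0_eq h00; apply/eqP/ffunP => e.
    by have := h00 e; rewrite !inE ffunE => /negbFE/eqP.
  move=> /(even_selection_cycle linH selH evh)[m /gmin gm mh].
  have := leq_trans gm mh; rewrite leq_eqVlt mulr1n => /orP[/eqP <-|gh].
    rewrite exprNn -signr_odd oddg expr1 mulN1r.
    by rewrite (@le_trans _ _ 0) ?oppr_le0 ?exprn_ge0 ?ltW.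
  apply: (le_trans (ler_norm _)); rewrite normrX normrN gtr0_norm //.
  by rewrite ler_wiXn2l // ltW.
(* Counting all functions, admissible or not, is affordable: [eps] times their number is below 1, so
   the total stays below [eps ^+ g]. *)
apply: (@le_lt_trans _ _
  (\sum_(h : {ffun {set V} -> option (V * V)}) eps ^+ g.+1)).
  rewrite big_mkcond; apply: ler_sum => h _; case: ifP => [/andP[/andP[]]|_].
    by move=> *; exact: term_le.
  by rewrite exprn_ge0 ?ltW.
by rewrite sumr_const -mulr_natr exprSr -mulrA gtr_pMr ?exprn_gt0.
Qed.

End PairSelection.

Local Open Scope classical_set_scope.
Local Open Scope ring_scope.

(** * Integrals of functions of the half-interval colouring *)

Section Coloring.
Variables (R : realType) (n : nat).
Local Notation RT := (measurableTypeR R).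

Definition coloring (x : n.-tuple RT) : {ffun 'I_n -> bool} :=
  [ffun i => 2^-1 <= (tnth x i : R)].

Definition half_line (b : bool) : set RT :=
  [set x | (2^-1 <= (x : R)) = b].

Lemma half_lineE b : half_line b =
  (if b then `[2^-1, +oo[%classic else `]-oo, 2^-1[%classic) :> set R.
Proof.
apply/seteqP; split=> x; case: b; rewrite /half_line /= in_itv /= ?andbT //.
- by rewrite ltNge => ->.
- by rewrite ltNge => /negbTE.
Qed.

Lemma measurable_box (A : 'I_n -> set RT) : (forall i, measurable (A i)) ->
  measurable [set x : n.-tuple RT | forall i, A i (tnth x i)].
Proof.
move=> mA; rewrite (_ : mkset _ =
  \bigcap_(i in setT) ((@tnth n RT)^~ i @^-1` A i)).
  apply: fin_bigcap_measurable => // i _; rewrite -[X in measurable X]setTI.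
  exact: measurable_tnth.
by apply/seteqP; split => x /= Ax i => [_|]; exact: Ax.
Qed.

Lemma measurable_half_line b : measurable (half_line b).
Proof. by case: b; rewrite half_lineE; exact: measurable_itv. Qed.

Lemma coloring_fiber (c : {ffun 'I_n -> bool}) :
  coloring @^-1` [set c] = [set x | forall i, half_line (c i) (tnth x i)].
Proof.
apply/seteqP; split=> x /= => [<- i|xc]; first by rewrite /half_line /= ffunE.
by apply/ffunP => i; rewrite ffunE; exact: xc.
Qed.

Lemma measurable_coloring_fiber (c : {ffun 'I_n -> bool}) :
  measurable (coloring @^-1` [set c]).
Proof.
rewrite coloring_fiber.
apply: (measurable_box (A := fun i => half_line (c i))) => i.
exact: measurable_half_line.
Qed.

Lemma measurable_unit_cube : measurable (@unit_cube R n).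
Proof.
rewrite (_ : @unit_cube R n =
  [set x | forall i, `[0 : R, 1]%classic (tnth x i)]).
  by apply: (measurable_box (A := fun=> `[0 : R, 1]%classic)) => i; exact: measurable_itv.
by apply/seteqP; split=> x /= xc i; have := xc i; rewrite /= in_itv.
Qed.

Lemma tuple_lebesgue_coloring_fiber (c : {ffun 'I_n -> bool}) :
  tuple_lebesgue (coloring @^-1` [set c] `&` @unit_cube R n) =
    (2^-1 ^+ n)%:E.
Proof.
have half_cell b : (half_line b `&` `[0 : R, 1]%classic) =
    (if b then `[2^-1, 1]%classic else `[0, 2^-1[%classic) :> set R.
  rewrite half_lineE; apply/seteqP; split=> x; case: b;
    rewrite /= !in_itv /= ?andbT; lra.
rewrite coloring_fiber (_ : _ `&` _ =
  [set x | forall i, (half_line (c i) `&` `[0 : R, 1]%classic) (tnth x i)]).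
  rewrite (tuple_lebesgue_box (A := fun i => half_line (c i) `&` `[0 : R, 1]%classic)) => [|i].
    rewrite (eq_bigr (fun=> (2^-1)%:E)) => [|i _].
      by rewrite prodEFin prodr_const card_ord.
    rewrite half_cell; case: (c i); rewrite lebesgue_measure_itv /= lte_fin.
    - rewrite ifT -?EFinB; [congr EFin|]; lra.
    - rewrite ifT -?EFinB; [congr EFin|]; lra.
  by apply: measurableI; [exact: measurable_half_line|exact: measurable_itv].
apply/seteqP; split=> x /= => [[xc x01] i|xc].
  by split; [exact: xc|rewrite in_itv /=; exact: x01].
by split=> i; have [? ] := xc i; rewrite // in_itv.
Qed.

(** Such a function is simple, which yields its measurability and its integral term by term. *)
Lemma coloring_decomposition (F : {ffun 'I_n -> bool} -> R) (x : n.-tuple RT) :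
  F (coloring x) = \sum_c F c * \1_(coloring @^-1` [set c]) x.
Proof.
rewrite (bigD1 (coloring x)) //= indicE mem_set // mulr1 big1 ?addr0 // => c cx.
rewrite indicE memNset ?mulr0 //= => xc.
by move: cx; rewrite xc eqxx.
Qed.

Lemma measurable_fun_coloring (D : set (n.-tuple RT))
    (F : {ffun 'I_n -> bool} -> R) :
  measurable_fun D (fun x => F (coloring x)).
Proof.
under [X in measurable_fun _ X]funext => x do rewrite coloring_decomposition.
apply: measurable_sum => c; apply: measurable_funM; first exact: measurable_cst.
by apply: measurable_indic; exact: measurable_coloring_fiber.
Qed.

(** All colouring cells of the cube have the same volume, so the integral is the average over
    colourings. *)
Lemma Rintegral_coloring (F : {ffun 'I_n -> bool} -> R) :
  \int[@tuple_lebesgue R n]_(x in @unit_cube R n) F (coloring x) =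
    2^-1 ^+ n * \sum_c F c.
Proof.
rewrite /Rintegral.
under eq_integral => x _ do rewrite coloring_decomposition -sumEFin.
have mfib c := measurable_coloring_fiber c.
have intI c : (@tuple_lebesgue R n).-integrable (@unit_cube R n)
    (fun x => (\1_(coloring @^-1` [set c]) x)%:E).
  apply/integrableP; split.
    by apply/measurable_EFinP; exact: measurable_indic.
  under eq_integral => x _ do rewrite gee0_abs ?lee_fin //.
  rewrite integral_indic //=; last exact: measurable_unit_cube.
  by rewrite tuple_lebesgue_coloring_fiber ltry.
rewrite integral_sum.
- under eq_bigr => c _.
    under eq_integral => x _ do rewrite EFinM.
    rewrite integralZl //; last exact: measurable_unit_cube.
    rewrite integral_indic //=; last exact: measurable_unit_cube.
    rewrite tuple_lebesgue_coloring_fiber -EFinM.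
    over.
  by rewrite sumEFin /= mulr_sumr; apply: eq_bigr => c _; rewrite mulrC.
- exact: measurable_unit_cube.
- move=> c; under eq_fun do rewrite EFinM.
  by apply: integrableZl => //; exact: measurable_unit_cube.
Qed.

End Coloring.

(** The diagonal of the expanded square contributes [#|A|], since each [z v] squares to 1. *)
Lemma sqr_sum_signs (R : comPzRingType) (T : finType) (A : {set T}) (z : T -> R) :
  (forall v, z v * z v = 1) ->
  (\sum_(v in A) z v) ^+ 2 - #|A|%:R =
    \sum_(p : T * T | [&& p.1 != p.2, p.1 \in A & p.2 \in A]) z p.1 * z p.2.
Proof.
move=> z1; rewrite expr2 big_distrlr /=.
under eq_bigr => v vA do rewrite (bigD1 v) //= z1.
rewrite big_split /= sumr_const addrAC subrr add0r pair_big_dep /=; apply: eq_bigl => p.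
by rewrite eq_sym; case: (p.1 \in A); case: (p.2 \in A); case: eqVneq.
Qed.

(** * The kernel and its densities *)

Section Kernel.
Variables (R : realType) (eps : R).
Local Notation RT := (measurableTypeR R).

(** This is [(1 - eps f) / 2], with the sum [f] over ordered pairs in closed form: a squared sign
    sum minus its diagonal [r]. *)
Definition color_kernel r (c : {ffun 'I_r -> bool}) : R :=
  (1 - eps * ((\sum_i (-1) ^+ c i) ^+ 2 - r%:R)) / 2.

(** The squared sign sum lies between 0 and [r ^ 2], so [f] lies between [- r] and [r ^ 2 - r], and
    [eps f] between -1 and 1. *)
Lemma unit_color_kernel r : 0 <= eps -> eps * r%:R ^+ 2 <= 1 ->
  unit_kernel (fun x : r.-tuple RT => color_kernel (coloring x)).
Proof.
move=> eps0 epsr; split; first exact: measurable_fun_coloring.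
- move=> s x _; rewrite /color_kernel; congr ((1 - eps * (_ ^+ 2 - _)) / _).
  rewrite [RHS](reindex_inj (@perm_inj _ s)) /=; apply: eq_bigr => i _.
  by rewrite !ffunE tnth_mktuple.
- move=> x _; rewrite /color_kernel; set S := \sum_i _.
  have Sr : `|S| <= r%:R.
    apply: (le_trans (ler_norm_sum _ _ _)).
    under eq_bigr do rewrite normr_sign.
    by rewrite sumr_const card_ord.
  have S2r : eps * S ^+ 2 <= eps * r%:R ^+ 2.
    by rewrite ler_wpM2l // -[S ^+ 2]real_normK ?num_real // lerXn2r ?nnegrE.
  have S0 : 0 <= eps * S ^+ 2 by rewrite mulr_ge0 ?sqr_ge0.
  have r0 : 0 <= eps * r%:R by rewrite mulr_ge0.
  have r2 : eps * r%:R <= eps * r%:R ^+ 2.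
    by rewrite ler_wpM2l // -natrX ler_nat; case: (r) => // k; rewrite leq_pmulr.
  rewrite mulrBr; apply/andP; split; lra.
Qed.

Lemma edge_density_color_kernel r :
  edge_density (fun x : r.-tuple RT => color_kernel (coloring x)) = 2^-1.
Proof.
rewrite /edge_density Rintegral_coloring.
rewrite /color_kernel -mulr_suml sumrB -mulr_sumr.
have -> : \sum_(c : {ffun 'I_r -> bool})
    ((\sum_i (-1) ^+ c i) ^+ 2 - r%:R) = 0 :> R.
  under eq_bigr => c _.
    rewrite -[in r%:R](card_ord r) -cardsT.
    under eq_bigl => i do rewrite -(finset.in_setT i).
    rewrite sqr_sum_signs => [|i]; last by rewrite -expr2 sqrr_sign.
    over.
  rewrite exchange_big big1 //= => p pP.
  (* The full index set serves as the single edge of an auxiliary hypergraph. *)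
  apply: (@sum_pair_sign1 _ _ [set [set: 'I_r]%SET]%SET [set: 'I_r]%SET).
  by move: pP; rewrite /= !inE eqxx.
rewrite mulr0 subr0 sumr_const card_ffun card_bool card_ord natrX.
by rewrite mulrA -exprMn mulVf ?expr1n ?mul1r.
Qed.

Lemma color_kernel_edge_coords (V : finType) r (H : {set {set V}}) e
    (x : #|V|.-tuple RT) : uniform_hypergraph r H -> e \in H ->
  color_kernel (coloring (edge_coords r x e)) =
  (1 - eps * \sum_(p | selectable H e (Some p))
      pair_sign R [ffun v => coloring x (enum_rank v)] (Some p)) / 2.
Proof.
move=> /[swap] eH /(_ _ eH) er; rewrite /color_kernel; congr ((1 - eps * _) / _).
have -> : \sum_(i < r) (-1) ^+ coloring (edge_coords r x e) i =
    \sum_(v in e) (-1) ^+ coloring x (enum_rank v) :> R.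
  pose t := [seq tnth x (enum_rank v) | v <- enum e].
  (* By uniformity the list has length [r], so the default of [nth] is never read. *)
  have st : size t = r by rewrite size_map -cardE.
  transitivity (\sum_(y <- t) (-1) ^+ ((2^-1 <= (y : R))%R : bool) : R).
    rewrite (big_nth 0) st big_mkord; apply: eq_bigr => i _.
    by rewrite ffunE tnth_mktuple.
  by rewrite big_map big_enum; apply: eq_bigr => v _; rewrite ffunE.
rewrite -er sqr_sum_signs => [|v]; last by rewrite -expr2 sqrr_sign.
apply: eq_big => p; first by rewrite /= eH.
by rewrite /pair_sign !ffunE.
Qed.

Lemma hom_density_color_kernel (V : finType) r (H : {set {set V}}) :
  uniform_hypergraph r H ->
  hom_density H (fun x : r.-tuple RT => color_kernel (coloring x)) =
  2^-1 ^+ #|H| * (2^-1 ^+ #|V| * \sum_(s : {ffun V -> bool}) \prod_(e in H)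
     (1 - eps * \sum_(p | selectable H e (Some p)) pair_sign R s (Some p))).
Proof.
move=> unifH; rewrite /hom_density.
pose G (s : {ffun V -> bool}) : R := \prod_(e in H)
  (1 - eps * \sum_(p | selectable H e (Some p)) pair_sign R s (Some p)).
pose F (c : {ffun 'I_#|V| -> bool}) : R :=
  2^-1 ^+ #|H| * G [ffun v => c (enum_rank v)].
under eq_Rintegral => x _.
  under eq_bigr => e eH do rewrite (color_kernel_edge_coords _ unifH eH).
  rewrite big_split /= prodr_const mulrC -/(F (coloring x)).
  over.
rewrite Rintegral_coloring -mulr_sumr mulrCA; congr (_ * (_ * _)).
rewrite [RHS](reindex (fun c : {ffun 'I_#|V| -> bool} =>
  [ffun v => c (enum_rank v)])) //=.
exists (fun s : {ffun V -> bool} => [ffun i => s (enum_val i)]) => c _;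
  by apply/ffunP => i; rewrite !ffunE ?enum_valK ?enum_rankK.
Qed.

End Kernel.

Theorem theorem3p1 (R : realType) (r : nat) (V : finType) (H : {set {set V}})
    (g : nat) :
  (2 <= r)%N -> uniform_hypergraph r H -> linear_hypergraph H ->
  girth_is H g -> odd g -> ~ sidorenko R r H.
Proof.
move=> _ unifH linH girthH oddg.
set N := #|{ffun {set V} -> option (V * V)}|.
(* The choice [eps = D^-1] meets all three smallness conditions at once, one per summand of [D]. *)
pose D : R := N%:R + r%:R ^+ 2 + 1.
have N0 : 0 <= N%:R :> R by [].
have r0 : 0 <= r%:R ^+ 2 :> R by rewrite exprn_ge0.
have D0 : 0 < D by rewrite /D; lra.
have Deps : D^-1 * D = 1 by rewrite mulVf ?gt_eqF.
have eps0 : 0 < D^-1 by rewrite invr_gt0.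
have [epsN epsr eps1] : [/\ D^-1 * N%:R < 1, D^-1 * r%:R ^+ 2 <= 1 & D^-1 <= 1].
  have := mulr_ge0 (ltW eps0) N0; have := mulr_ge0 (ltW eps0) r0.
  by move: Deps; rewrite /D !mulrDr mulr1 -/D => ? ? ?; split; lra.
move=> /(_ _ (unit_color_kernel (ltW eps0) epsr)); apply/negP; rewrite -ltNge.
rewrite hom_density_color_kernel // edge_density_color_kernel.
rewrite gtr_pMr ?exprn_gt0 ?invr_gt0 // exprVn mulrC ltr_pdivrMr ?exprn_gt0 //.
by rewrite mul1r; exact: sum_prod_selection_lt linH girthH oddg eps0 eps1 epsN.
Qed.
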